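(* Consider surfaces $S$ in the pseudo-isotropic space $\mathbb{I}_{\mathrm p}^3$, with the symmetric bilinear form induced on $S$ by $\langle\cdot,\cdot\rangle_{pz}$. Every admissible surface $S\subset\mathbb{I}_{\mathrm p}^3$ is timelike. In addition, there exists no spacelike surface in $\mathbb{I}_{\mathrm p}^3$, and every lightlike surface in $\mathbb{I}_{\mathrm p}^3$ is non-admissible.
   Context: The pseudo-isotropic space $\mathbb{I}_{\mathrm p}^3$ is $\mathbb{R}^3$ with coordinates $(x,y,z)$ and the degenerate inner product $\langle \mathbf u,\mathbf v\rangle_{pz}=u^1v^1-u^2v^2$. A line parallel to the $z$-axis is an isotropic line, and a plane containing an isotropic line is an isotropic plane. Surfaces are smooth immersed surfaces $\mathbf{x}:S\to\mathbb{I}_{\mathrm p}^3$. A surface is admissible if none of its tangent planes is isotropic, and non-admissible otherwise. The induced form is $g(u,v)=\langle \mathrm d\mathbf x(u),\mathrm d\mathbf x(v)\rangle_{pz}$ on each tangent plane. A surface is timelike if $g$ is non-degenerate of index 1 at every point, spacelike if $g$ is positive definite at every point, and lightlike if $g$ is degenerate at every point. *)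

(* Defs.v *)
From mathcomp Require Export all_boot all_order all_algebra.
From mathcomp Require Export all_classical all_reals all_analysis.

Set Implicit Arguments.
Unset Strict Implicit.
Unset Printing Implicit Defensive.

Import Order.TTheory GRing.Theory Num.Theory.
Import numFieldNormedType.Exports.

Local Open Scope classical_set_scope.
Local Open Scope ring_scope.

(* Only meaningful for U open: f is total, but differentiability at a point of
   an open U depends only on the values of f on U. *)
Fixpoint Ck (R : realType) (m n k : nat) (U : set 'rV[R]_m.+1)
    (f : 'rV[R]_m.+1 -> 'rV[R]_n.+1) : Prop :=
  match k with
  | 0%N => {within U, continuous f}
  | k'.+1 => (forall a, U a -> differentiable f a) /\
             (forall v : 'rV[R]_m.+1, Ck k' U (fun a => 'D_v f a))
  end.

Definition smooth_on (R : realType) (m n : nat) (U : set 'rV[R]_m.+1)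
    (f : 'rV[R]_m.+1 -> 'rV[R]_n.+1) : Prop :=
  forall k : nat, Ck k U f.

(* The two maps are total functions; only their restrictions to chart_dom and
   to the image of chart_dom matter. *)
Record chart (R : realType) (T : topologicalType) := Chart {
  chart_dom : set T;
  chart_map : T -> 'rV[R]_2;
  chart_inv : 'rV[R]_2 -> T;
  chart_dom_open : open chart_dom;
  chart_img_open : open (chart_map @` chart_dom);
  chart_invK : forall p, chart_dom p -> chart_inv (chart_map p) = p;
  chart_map_continuous : {within chart_dom, continuous chart_map};
  chart_inv_continuous :
    {within chart_map @` chart_dom, continuous chart_inv} }.

Definition transition (R : realType) (T : topologicalType) (c d : chart R T) :
    'rV[R]_2 -> 'rV[R]_2 :=
  chart_map d \o chart_inv c.

(* An atlas is not required to be maximal: any atlas determines the smooth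
   structure. *)
Record smooth_2manifold (R : realType) := Smooth2Manifold {
  carrier :> topologicalType;
  atlas : set (chart R carrier);
  carrier_nonempty : [set: carrier] !=set0;
  carrier_hausdorff : hausdorff_space carrier;
  carrier_second_countable : @second_countable carrier;
  atlas_cover : forall p : carrier, exists2 c, atlas c & chart_dom c p;
  atlas_smooth : forall c d, atlas c -> atlas d ->
    smooth_on (chart_map c @` (chart_dom c `&` chart_dom d))
              (transition c d) }.

Definition chart_at (R : realType) (S : smooth_2manifold R) (p : S)
    (c : chart R S) : Prop :=
  atlas c /\ chart_dom c p.

(* A chart c at p identifies T_p S with 'rV_2, and [tangent_map x c p] is the
   differential of x at p read through this identification.  For smooth x,
   changing c precomposes it with the differential of a transition map, a linear
   automorphism of 'rV_2; so the notions below, quantified over all charts at p,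
   do not depend on the chart. *)
Definition tangent_map (R : realType) (S : smooth_2manifold R)
    (x : S -> 'rV[R]_3) (c : chart R S) (p : S) : 'rV[R]_2 -> 'rV[R]_3 :=
  'd (x \o chart_inv c) (chart_map c p).

Definition smooth_map (R : realType) (S : smooth_2manifold R)
    (x : S -> 'rV[R]_3) : Prop :=
  forall c, atlas c ->
    smooth_on (chart_map c @` chart_dom c) (x \o chart_inv c).

Definition immersion (R : realType) (S : smooth_2manifold R)
    (x : S -> 'rV[R]_3) : Prop :=
  smooth_map x /\
  forall p c, chart_at p c -> injective (tangent_map x c p).

Record surface (R : realType) := Surface {
  surface_dom :> smooth_2manifold R;
  surface_map : surface_dom -> 'rV[R]_3;
  surface_immersion : immersion surface_map }.

(* Coordinates (x, y, z) have indices 0, 1, 2. *)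
Definition pz_product (R : realType) (u v : 'rV[R]_3) : R :=
  u ord0 (inord 0) * v ord0 (inord 0) - u ord0 (inord 1) * v ord0 (inord 1).

Definition isotropic_line (R : realType) (L : set 'rV[R]_3) : Prop :=
  exists q : 'rV[R]_3,
    L = [set q + t *: delta_mx ord0 (inord 2) | t in [set: R]].

Definition plane (R : realType) (P : set 'rV[R]_3) : Prop :=
  exists (q : 'rV[R]_3) (W : {vspace 'rV[R]_3}),
    \dim W = 2%N /\ P = [set q + w | w in [set w | w \in W]].

Definition isotropic_plane (R : realType) (P : set 'rV[R]_3) : Prop :=
  plane P /\ exists2 L, isotropic_line L & L `<=` P.

Definition tangent_plane (R : realType) (S : surface R) (c : chart R S)
    (p : S) : set 'rV[R]_3 :=
  [set surface_map p + tangent_map (@surface_map R S) c p v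
     | v in [set: 'rV[R]_2]].

Definition admissible (R : realType) (S : surface R) : Prop :=
  forall (p : S) c, chart_at p c -> ~ isotropic_plane (tangent_plane c p).

Definition induced_form (R : realType) (S : surface R) (c : chart R S) (p : S)
    (u v : 'rV[R]_2) : R :=
  pz_product (tangent_map (@surface_map R S) c p u)
             (tangent_map (@surface_map R S) c p v).

Definition nondegenerate_form (R : realType) (V : vectType R)
    (b : V -> V -> R) : Prop :=
  forall u, (forall v, b u v = 0) -> u = 0.

Definition positive_definite_form (R : realType) (V : vectType R)
    (b : V -> V -> R) : Prop :=
  forall u, u != 0 -> 0 < b u u.

Definition negative_definite_on (R : realType) (V : vectType R)
    (b : V -> V -> R) (W : {vspace V}) : Prop :=
  forall u, u \in W -> u != 0 -> b u u < 0.

(* The index is the largest dimension of a subspace on which the form is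
   negative definite. *)
Definition form_index (R : realType) (V : vectType R) (b : V -> V -> R)
    (k : nat) : Prop :=
  (exists W : {vspace V}, \dim W = k /\ negative_definite_on b W) /\
  (forall W : {vspace V}, negative_definite_on b W -> (\dim W <= k)%N).

Definition timelike (R : realType) (S : surface R) : Prop :=
  forall (p : S) c, chart_at p c ->
    nondegenerate_form (induced_form c p) /\ form_index (induced_form c p) 1%N.

Definition spacelike (R : realType) (S : surface R) : Prop :=
  forall (p : S) c, chart_at p c -> positive_definite_form (induced_form c p).

Definition lightlike (R : realType) (S : surface R) : Prop :=
  forall (p : S) c, chart_at p c -> ~ nondegenerate_form (induced_form c p).

(* Main.v *)
Require Import Defs.

Set Implicit Arguments.
Unset Strict Implicit.
Unset Printing Implicit Defensive.

Import Order.TTheory GRing.Theory Num.Theory.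
Import numFieldNormedType.Exports.

Local Open Scope classical_set_scope.
Local Open Scope ring_scope.

(** The form on the ambient space depends only on the first two coordinates: it
    is the pullback of the Lorentz form [a0 b0 - a1 b1] of the plane under the
    top view, the projection along the isotropic direction.  The kernel of the
    top view is exactly that direction, so, for an injective linear map
    [L] from a plane into space, there are two cases ([isotropic_or_bijective]).
    Either the image of [L] contains the isotropic vector, and the plane is
    isotropic ([isotropic_plane_of_vector]); or the top view of [L] is injective,
    hence by dimension bijective, and carries the induced form to the Lorentz
    form, which is nondegenerate of index 1 ([lorentz_pullback]).

    This applies to the differential of the surface at each point.  Admissibility
    excludes the first case, whence timelike.  A positive definite form is
    impossible in both cases: in the first the isotropic vector has square 0, in
    the second some vector has square -1.  Finally, a lightlike surface that was
    admissible would be timelike, and its form both degenerate and nondegenerate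
    at any point; surfaces have points, as they are nonempty by definition. *)

Definition isotropic_vector (R : realType) : 'rV[R]_3 := delta_mx ord0 (inord 2).

Definition top_view (R : realType) : {linear 'rV[R]_3 -> 'rV[R]_2} :=
  (@lsubmx R 1 2 1 : {linear 'rV[R]_(2 + 1) -> 'rV[R]_2}).

Lemma top_viewE (R : realType) (v : 'rV[R]_3) (j : 'I_2) :
  top_view R v ord0 j = v ord0 (inord j).
Proof.
rewrite [LHS]mxE; congr (v _ _); apply/val_inj => /=.
by rewrite inordK // (leq_trans (ltn_ord j)).
Qed.

Lemma pz_product_top_view (R : realType) (u v : 'rV[R]_3) :
  pz_product u v = top_view R u 0 0 * top_view R v 0 0
                   - top_view R u 0 1 * top_view R v 0 1.
Proof. by rewrite !top_viewE. Qed.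

Lemma top_view_eq0 (R : realType) (v : 'rV[R]_3) :
  top_view R v = 0 -> v = v 0 (inord 2) *: isotropic_vector R.
Proof.
move=> v0; apply/rowP => j; rewrite !mxE eqxx /=.
have [->|jN2] := eqVneq j (inord 2); first by rewrite mulr1.
have lt_j2 : (j < 2)%N.
  rewrite ltn_neqAle -ltnS ltn_ord andbT.
  by apply: contraNneq jN2 => j2; apply/eqP/val_inj; rewrite /= inordK.
rewrite mulr0; have := top_viewE v (Ordinal lt_j2).
by rewrite v0 mxE /= inord_val => <-.
Qed.

Lemma pz_product_isotropic (R : realType) (v : 'rV[R]_3) :
  pz_product (isotropic_vector R) v = 0.
Proof.
rewrite /pz_product !mxE /= -!val_eqE /= !inordK //.
by rewrite !mul0r subr0.
Qed.

(** A vector in the kernel of the top view of [L] is sent by [L] to a multiple of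
    the isotropic vector, nonzero as [L] is injective.  If there is none, the top
    view of [L] is an injective endomorphism of the plane. *)
Lemma isotropic_or_bijective (R : realType)
    (L : {linear 'rV[R]_2 -> 'rV[R]_3}) :
  injective L ->
  (exists u, L u = isotropic_vector R) \/
  bijective (fun u => top_view R (L u)).
Proof.
move=> Linj.
pose T : 'End('rV[R]_2) := linfun (top_view R \o L).
have TE u : T u = top_view R (L u) by rewrite lfunE.
have [kerT0|kerTN0] := eqVneq (lker T) 0%VS.
  right; exists (T^-1)%VF => u; rewrite -TE.
    by apply: lker0_lfunK; rewrite kerT0.
  by apply: lker0_lfunVK; rewrite kerT0.
left; set u := vpick (lker T).
have uN0 : u != 0 by rewrite vpick0.
have /top_view_eq0 Lu : top_view R (L u) = 0.
  by rewrite -TE; apply/eqP; rewrite -memv_ker memv_pick.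
exists ((L u 0 (inord 2))^-1 *: u).
rewrite linearZ /= {2}Lu scalerA mulVf ?scale1r //.
apply: contraNneq uN0 => z0; apply/eqP/Linj.
by rewrite linear0 Lu z0 scale0r.
Qed.

Lemma isotropic_plane_of_vector (R : realType) (q : 'rV[R]_3)
    (L : {linear 'rV[R]_2 -> 'rV[R]_3}) (u : 'rV[R]_2) :
  injective L -> L u = isotropic_vector R ->
  isotropic_plane [set q + L v | v in [set: 'rV[R]_2]].
Proof.
move=> Linj Lu; split; last first.
  exists [set q + t *: isotropic_vector R | t in [set: R]]; first by exists q.
  by move=> _ [t _ <-]; exists (t *: u) => //; rewrite linearZ /= Lu.
exists q, (limg (linfun L)); split.
  rewrite limg_dim_eq ?dimvf //=.
  have /eqP-> : lker (linfun L) == 0%VS.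
    by apply/lker0P => v w; rewrite !lfunE; apply: Linj.
  exact: capv0.
apply/seteqP; split=> [_ [v _ <-]|_ [w /memv_imgP[v _ ->] <-]].
  by exists (L v) => //=; apply/memv_imgP; exists v; rewrite ?memvf ?lfunE.
by exists v; rewrite ?lfunE.
Qed.

(** The preimages [u0], [u1] of the unit vectors form an orthogonal basis with
    squares 1 and -1.  Pairing with them reads off the coordinates of the top
    view, whence nondegeneracy.  The line of [u1] is negative definite; a negative
    definite subspace of larger dimension would be the whole plane, and contain
    [u0]. *)
Lemma lorentz_pullback (R : realType) (L : {linear 'rV[R]_2 -> 'rV[R]_3}) :
  bijective (fun u => top_view R (L u)) ->
  nondegenerate_form (fun u v => pz_product (L u) (L v)) /\
  form_index (fun u v => pz_product (L u) (L v)) 1.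
Proof.
move=> Tbij; have Tinj := bij_inj Tbij; case: Tbij => T' _ T'K.
pose u0 := T' (delta_mx 0 0); pose u1 := T' (delta_mx 0 1).
have Tu0 : top_view R (L u0) = delta_mx 0 0 by exact: T'K.
have Tu1 : top_view R (L u1) = delta_mx 0 1 by exact: T'K.
have pzu0 u : pz_product (L u) (L u0) = top_view R (L u) 0 0.
  by rewrite pz_product_top_view Tu0 2![delta_mx _ _ _ _]mxE /= mulr1 mulr0 subr0.
have pzu1 u : pz_product (L u) (L u1) = - top_view R (L u) 0 1.
  by rewrite pz_product_top_view Tu1 2![delta_mx _ _ _ _]mxE /= mulr1 mulr0 sub0r.
have pzu00 : pz_product (L u0) (L u0) = 1 by rewrite pzu0 Tu0 mxE.
have pzu11 : pz_product (L u1) (L u1) = -1 by rewrite pzu1 Tu1 mxE.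
have pz0 v : pz_product (L 0) (L v) = 0.
  by rewrite linear0 /pz_product !mxE !mul0r subr0.
have u0N0 : u0 != 0.
  by apply/eqP => u00; have /eqP := pzu00; rewrite {1}u00 pz0 eq_sym oner_eq0.
have u1N0 : u1 != 0.
  apply/eqP => u10; have /eqP := pzu11.
  by rewrite {1}u10 pz0 eq_sym oppr_eq0 oner_eq0.
split.
  move=> u u_orth; apply: Tinj; rewrite !linear0; apply/rowP => j.
  rewrite [RHS]mxE.
  have [->|->] : j = 0 \/ j = 1.
    by case: j => [[|[|[]]]//= ?]; [left|right]; apply/val_inj.
  - by rewrite -pzu0.
  - by apply/eqP; rewrite -oppr_eq0 -pzu1 u_orth.
split.
  exists <[u1]>%VS; split; first by rewrite dim_vline u1N0.
  move=> _ /vlineP[k ->]; rewrite scaler_eq0 negb_or => /andP[kN0 _].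
  have -> : pz_product (L (k *: u1)) (L (k *: u1)) = - k ^+ 2.
    rewrite -[RHS]mulrN1 -pzu11 linearZ /= /pz_product !mxE expr2.
    by rewrite mulrBr; congr (_ - _); apply: mulrACA.
  by rewrite oppr_lt0 exprn_even_gt0.
move=> W Wneg; rewrite leqNgt; apply/negP => W_big.
have WT : W = fullv.
  by apply/eqP; rewrite eqEdim subvf dimvf.
have := Wneg u0; rewrite WT memvf u0N0 pzu00 => /(_ isT isT).
by rewrite ltr10.
Qed.

Lemma no_positive_definite_pullback (R : realType)
    (L : {linear 'rV[R]_2 -> 'rV[R]_3}) :
  injective L ->
  ~ positive_definite_form (fun u v => pz_product (L u) (L v)).
Proof.
move=> Linj pos; have [[u Lu]|Tbij] := isotropic_or_bijective Linj.
  have uN0 : u != 0.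
    apply/eqP => u0; have := congr1 (fun w : 'rV_3 => w 0 (inord 2)) Lu.
    by rewrite u0 linear0 !mxE !eqxx => /esym/eqP; rewrite oner_eq0.
  by have := pos u uN0; rewrite Lu pz_product_isotropic ltxx.
have [_ [[W [dimW Wneg]] _]] := lorentz_pullback Tbij.
have WN0 : W != 0%VS by rewrite -dimv_eq0 dimW.
have uN0 : vpick W != 0 by rewrite vpick0.
by have := lt_trans (pos _ uN0) (Wneg _ (memv_pick W) uN0); rewrite ltxx.
Qed.

Lemma chart_at_exists (R : realType) (S : surface R) :
  exists (p : S) (c : chart R S), chart_at p c.
Proof.
have [p _] := carrier_nonempty S.
by have [c ac cp] := atlas_cover p; exists p, c.
Qed.

Lemma admissible_timelike (R : realType) (S : surface R) :
  admissible S -> timelike S.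
Proof.
move=> adm p c pc; have Linj := (surface_immersion S).2 p c pc.
have [[u Lu]|Tbij] := isotropic_or_bijective Linj.
  by case: (adm p c pc); apply: isotropic_plane_of_vector Linj Lu.
exact: lorentz_pullback Tbij.
Qed.

Theorem proposition1 (R : realType) :
  (forall S : surface R, admissible S -> timelike S) /\
  (~ exists S : surface R, spacelike S) /\
  (forall S : surface R, lightlike S -> ~ admissible S).
Proof.
split; first exact: admissible_timelike.
split=> [[S space]|S light adm]; have [p [c pc]] := chart_at_exists S.
  have Linj := (surface_immersion S).2 p c pc.
  exact: no_positive_definite_pullback Linj (space p c pc).
exact: light p c pc (admissible_timelike adm pc).1.
Qed.
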